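(* Let $\mathcal{B}$ be an abelian category with enough projective objects and enough injective objects, let $\mathsf{F}:\mathcal{B}\to\mathcal{B}$ be an additive right exact functor, and let $\mathcal{B}\ltimes\mathsf{F}$ be the right trivial extension of $\mathcal{B}$ by $\mathsf{F}$. Let $(\mathcal{X},\mathcal{Y})$ be a hereditary complete cotorsion pair in $\mathcal{B}$. If $\mathbb{L}_1\mathsf{F}(X)=0$ for all $X\in\mathcal{X}$ and $\mathsf{F}(\mathcal{X})\subseteq\mathcal{Y}$, then $({}^{\perp}\mathsf{U}^{-1}(\mathcal{Y}),\,\mathsf{U}^{-1}(\mathcal{Y}))$ is a hereditary complete cotorsion pair in $\mathcal{B}\ltimes\mathsf{F}$.
   Context: The right trivial extension $\mathcal{B}\ltimes\mathsf{F}$ has as objects the pairs $(X,f)$ with $X\in\mathcal{B}$ and $f:\mathsf{F}(X)\to X$ such that $f\circ\mathsf{F}(f)=0$; a morphism $(X,f)\to(Y,g)$ is a morphism $\alpha:X\to Y$ in $\mathcal{B}$ with $\alpha\circ f=g\circ\mathsf{F}(\alpha)$. This is an abelian category with enough projectives, in which a sequence is exact if and only if the underlying sequence in $\mathcal{B}$ is exact. $\mathbb{L}_1\mathsf{F}$ is the first left derived functor of $\mathsf{F}$. $\mathsf{U}^{-1}(\mathcal{Y})=\{(X,f)\in\mathcal{B}\ltimes\mathsf{F} : X\in\mathcal{Y}\}$. For a class $\mathcal{S}$ of objects in an abelian category $\mathcal{A}$: ${}^{\perp}\mathcal{S}=\{Y : \mathrm{Ext}^1_{\mathcal{A}}(Y,S)=0\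 \forall S\in\mathcal{S}\}$ and $\mathcal{S}^{\perp}=\{Y : \mathrm{Ext}^1_{\mathcal{A}}(S,Y)=0\ \forall S\in\mathcal{S}\}$. A pair $(\mathcal{C},\mathcal{D})$ is a cotorsion pair if $\mathcal{C}={}^{\perp}\mathcal{D}$ and $\mathcal{D}=\mathcal{C}^{\perp}$. It is complete if for every object $A$ there are exact sequences $0\to D\to C\to A\to 0$ and $0\to A\to D'\to C'\to 0$ with $C,C'\in\mathcal{C}$ and $D,D'\in\mathcal{D}$. It is hereditary if $\mathrm{Ext}^i_{\mathcal{A}}(C,D)=0$ for all $i\ge 1$, $C\in\mathcal{C}$, $D\in\mathcal{D}$ (when $\mathcal{A}$ has enough projectives and injectives, equivalently $\mathcal{C}$ is closed under kernels of epimorphisms, equivalently $\mathcal{D}$ is closed under cokernels of monomorphisms). *)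

(* Defs.v *)
From HB Require Import structures.
From mathcomp Require Import all_boot all_algebra boolp.

Set Implicit Arguments.
Unset Strict Implicit.
Unset Printing Implicit Defensive.

Import GRing.Theory.
Local Open Scope ring_scope.

(* The Hom groups are [zmodType]s. The choice structure that this class bundles
   exists on every abelian group by the axioms of [boolp], so it is no
   restriction. *)
Record precat := Precat {
  obj :> Type;
  hom : obj -> obj -> zmodType;
  idm : forall A, hom A A;
  cmp : forall A B C, hom B C -> hom A B -> hom A C;
  cmpA : forall A B C D (h : hom C D) (g : hom B C) (f : hom A B),
    cmp h (cmp g f) = cmp (cmp h g) f;
  cmp1m : forall A B (f : hom A B), cmp (idm B) f = f;
  cmpm1 : forall A B (f : hom A B), cmp f (idm A) = f;
  cmpDl : forall A B C (g g' : hom B C) (f : hom A B),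
    cmp (g + g') f = cmp g f + cmp g' f;
  cmpDr : forall A B C (g : hom B C) (f f' : hom A B),
    cmp g (f + f') = cmp g f + cmp g f' }.

Arguments hom {p}.
Arguments idm {p}.
Arguments cmp {p A B C}.

Notation "g '\c' f" := (cmp g f) (at level 40, left associativity) : ring_scope.

Section PrecatTheory.
Variable C : precat.
Implicit Types A B D W Z : C.

Lemma cmp0m A B D (f : hom A B) : (0 : hom B D) \c f = 0.
Proof. by apply: (addrI (0 \c f)); rewrite -cmpDl !addr0. Qed.

Lemma cmpm0 A B D (g : hom B D) : g \c (0 : hom A B) = 0.
Proof. by apply: (addrI (g \c 0)); rewrite -cmpDr !addr0. Qed.

Lemma cmpNl A B D (g : hom B D) (f : hom A B) : (- g) \c f = - (g \c f).
Proof. by apply: (addrI (g \c f)); rewrite -cmpDl !subrr cmp0m. Qed.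

Lemma cmpNr A B D (g : hom B D) (f : hom A B) : g \c (- f) = - (g \c f).
Proof. by apply: (addrI (g \c f)); rewrite -cmpDr !subrr cmpm0. Qed.

Lemma cmpBl A B D (g g' : hom B D) (f : hom A B) :
  (g - g') \c f = g \c f - g' \c f.
Proof. by rewrite cmpDl cmpNl. Qed.

Lemma cmpBr A B D (g : hom B D) (f f' : hom A B) :
  g \c (f - f') = g \c f - g \c f'.
Proof. by rewrite cmpDr cmpNr. Qed.

Definition is_zero Z : Prop :=
  (forall W (f g : hom W Z), f = g) /\ (forall W (f g : hom Z W), f = g).

Definition mono A B (m : hom A B) : Prop :=
  forall W (f g : hom W A), m \c f = m \c g -> f = g.

Definition epi A B (e : hom A B) : Prop :=
  forall W (f g : hom B W), f \c e = g \c e -> f = g.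

Definition is_kernel K A B (k : hom K A) (f : hom A B) : Prop :=
  f \c k = 0 /\ forall W (h : hom W A), f \c h = 0 -> exists! u, k \c u = h.

Definition is_cokernel A B D (c : hom B D) (f : hom A B) : Prop :=
  c \c f = 0 /\ forall W (h : hom B W), h \c f = 0 -> exists! u, u \c c = h.

Definition is_biproduct A B S (i1 : hom A S) (i2 : hom B S)
    (p1 : hom S A) (p2 : hom S B) : Prop :=
  [/\ p1 \c i1 = idm A, p2 \c i2 = idm B, p1 \c i2 = 0, p2 \c i1 = 0 &
      i1 \c p1 + i2 \c p2 = idm S].

Record kernel_of A B (f : hom A B) := KernelOf {
  ker : C;
  kerm : hom ker A;
  kermP : is_kernel kerm f }.

Record cokernel_of A B (f : hom A B) := CokernelOf {
  cok : C;
  cokm : hom B cok;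
  cokmP : is_cokernel cokm f }.

Record biproduct_of A B := BiproductOf {
  bip : C;
  inj1 : hom A bip;
  inj2 : hom B bip;
  prj1 : hom bip A;
  prj2 : hom bip B;
  bipP : is_biproduct inj1 inj2 prj1 prj2 }.

Definition projective P : Prop :=
  forall A B (e : hom A B), epi e ->
  forall f : hom P B, exists g : hom P A, e \c g = f.

Definition injective_obj I : Prop :=
  forall A B (m : hom A B), mono m ->
  forall f : hom A I, exists g : hom B I, g \c m = f.

Definition enough_projectives : Prop :=
  forall A, exists P (e : hom P A), projective P /\ epi e.

Definition enough_injectives : Prop :=
  forall A, exists I (m : hom A I), injective_obj I /\ mono m.

Lemma mono0P A B (m : hom A B) :
  (forall W (f : hom W A), m \c f = 0 -> f = 0) -> mono m.
Proof.
move=> m0 W f g e; apply/eqP; rewrite -subr_eq0; apply/eqP; apply: m0.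
by rewrite cmpBr e subrr.
Qed.

Lemma epi0P A B (e : hom A B) :
  (forall W (f : hom B W), f \c e = 0 -> f = 0) -> epi e.
Proof.
move=> e0 W f g efg; apply/eqP; rewrite -subr_eq0; apply/eqP; apply: e0.
by rewrite cmpBl efg subrr.
Qed.

Lemma kernel_mono K A B (k : hom K A) (f : hom A B) : is_kernel k f -> mono k.
Proof.
move=> [fk0 ku] W a b e.
have [|u [_ uu]] := ku W (k \c a); first by rewrite cmpA fk0 cmp0m.
by rewrite -(uu a erefl) -(uu b (esym e)).
Qed.

Lemma cokernel_epi A B D (c : hom B D) (f : hom A B) : is_cokernel c f -> epi c.
Proof.
move=> [cf0 cu] W a b e.
have [|u [_ uu]] := cu W (a \c c); first by rewrite -cmpA cf0 cmpm0.
by rewrite -(uu a erefl) -(uu b (esym e)).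
Qed.

Lemma kernel_lift K A B (k : hom K A) (f : hom A B) W (h : hom W A) :
  is_kernel k f -> f \c h = 0 -> exists u, k \c u = h.
Proof. by move=> [_ ku] /ku[u [ku1 _]]; exists u. Qed.

Lemma cokernel_desc A B D (c : hom B D) (f : hom A B) W (h : hom B W) :
  is_cokernel c f -> h \c f = 0 -> exists u, u \c c = h.
Proof. by move=> [_ cu] /cu[u [cu1 _]]; exists u. Qed.

Lemma is_kernelI K A B (k : hom K A) (f : hom A B) : f \c k = 0 -> mono k ->
  (forall W (h : hom W A), f \c h = 0 -> exists u, k \c u = h) -> is_kernel k f.
Proof.
move=> fk0 km kl; split=> // W h /kl[u ku]; exists u; split=> // v kv.
by apply: km; rewrite ku kv.
Qed.

Lemma is_cokernelI A B D (c : hom B D) (f : hom A B) : c \c f = 0 -> epi c ->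
  (forall W (h : hom B W), h \c f = 0 -> exists u, u \c c = h) ->
  is_cokernel c f.
Proof.
move=> cf0 ce cl; split=> // W h /cl[u cu]; exists u; split=> // v cv.
by apply: ce; rewrite cu cv.
Qed.

End PrecatTheory.

Record abelian := Abelian {
  acat :> precat;
  zobj : acat;
  zobjP : is_zero zobj;
  bips : forall A B : acat, biproduct_of A B;
  kers : forall (A B : acat) (f : hom A B), kernel_of f;
  coks : forall (A B : acat) (f : hom A B), cokernel_of f;
  mono_normal : forall (A B : acat) (m : hom A B), mono m ->
    exists (D : acat) (g : hom B D), is_kernel m g;
  epi_normal : forall (A B : acat) (e : hom A B), epi e ->
    exists (D : acat) (g : hom D A), is_cokernel e g }.

Notation Ker f := (ker (kers f)).
Notation ker_map f := (kerm (kers f)).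
Notation Cok f := (cok (coks f)).
Notation cok_map f := (cokm (coks f)).

Section AbelianTheory.
Variable C : abelian.
Implicit Types A B D K W : C.

Definition ker_lift A B D (f : hom A B) (g : hom B D) (gf0 : g \c f = 0) :
    hom A (Ker g) :=
  projT1 (cid (kernel_lift (kermP (kers g)) gf0)).

Lemma ker_liftE A B D (f : hom A B) (g : hom B D) (gf0 : g \c f = 0) :
  ker_map g \c ker_lift gf0 = f.
Proof. exact: projT2 (cid (kernel_lift (kermP (kers g)) gf0)). Qed.

Definition exact A B D (f : hom A B) (g : hom B D) : Prop :=
  exists gf0 : g \c f = 0, epi (ker_lift gf0).

Definition short_exact A B D (f : hom A B) (g : hom B D) : Prop :=
  [/\ mono f, exact f g & epi g].

Definition homology A B D (f : hom A B) (g : hom B D) (gf0 : g \c f = 0) : C :=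
  Cok (ker_lift gf0).

Lemma exactI K A B D (f : hom A B) (g : hom B D) (k : hom K B) (u : hom A K) :
  is_kernel k g -> k \c u = f -> epi u -> exact f g.
Proof.
move=> kg kuf ue; have gf0 : g \c f = 0 by rewrite -kuf cmpA kg.1 cmp0m.
exists gf0; have [v vE] := kernel_lift kg (kermP (kers g)).1.
have [w wE] := kernel_lift (kermP (kers g)) kg.1.
have km := kernel_mono (kermP (kers g)).
have wv1 : w \c v = idm _ by apply: km; rewrite cmpA wE vE cmpm1.
have le : ker_lift gf0 = w \c u by apply: km; rewrite ker_liftE cmpA wE kuf.
apply: epi0P => W h; rewrite le cmpA => hwu0.
have hw0 : h \c w = 0 by apply: ue; rewrite hwu0 cmp0m.
by rewrite -[h]cmpm1 -wv1 cmpA hw0 cmp0m.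
Qed.

Lemma exact_cmp0 A B D (f : hom A B) (g : hom B D) : exact f g -> g \c f = 0.
Proof. by case. Qed.

Lemma cokernel_exact A B D (f : hom A B) (c : hom B D) :
  is_cokernel c f -> exact f c.
Proof.
move=> cf; exists cf.1; set u := ker_lift _; set k := ker_map c.
have kuf : k \c u = f by exact: ker_liftE.
have kP : is_kernel k c := kermP (kers c).
apply: epi0P => W w wu0; pose k' := ker_map w.
have [u' u'E] := kernel_lift (kermP (kers w)) wu0.
have [|E [g gP]] := @mono_normal C _ _ (k \c k').
  apply: mono0P => V h; rewrite -cmpA => e.
  apply: (kernel_mono (kermP (kers w))); apply: (kernel_mono kP).
  by rewrite e !cmpm0.
have [|g' g'E] := @cokernel_desc _ _ _ _ c f _ g cf.
  by rewrite -kuf -u'E !cmpA -[g \c k \c _]cmpA gP.1 cmp0m.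
have [|s sE] := @kernel_lift _ _ _ _ _ _ _ k gP.
  by rewrite -g'E -cmpA kP.1 cmpm0.
have k's : k' \c s = idm _.
  by apply: (kernel_mono kP); rewrite cmpA sE cmpm1.
by rewrite -[w]cmpm1 -k's cmpA (kermP (kers w)).1 cmp0m.
Qed.

Lemma epi_cok_ker A B (e : hom A B) : epi e -> is_cokernel e (ker_map e).
Proof.
move=> ee; have [D [g gP]] := epi_normal ee.
apply: is_cokernelI => //; first exact: (kermP (kers e)).1.
move=> W h h0; apply: (cokernel_desc gP).
by have [u <-] := kernel_lift (kermP (kers e)) gP.1; rewrite cmpA h0 cmp0m.
Qed.

Lemma mono_ker_cok A B (m : hom A B) : mono m -> is_kernel m (cok_map m).
Proof.
move=> mm; have [D [g gP]] := mono_normal mm.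
apply: is_kernelI => //; first exact: (cokmP (coks m)).1.
move=> W h h0; apply: (kernel_lift gP).
by have [u <-] := cokernel_desc (cokmP (coks m)) gP.1; rewrite -cmpA h0 cmpm0.
Qed.

Lemma exact_cokernel A B D (f : hom A B) (g : hom B D) :
  exact f g -> epi g -> is_cokernel g f.
Proof.
move=> [gf0 le] ge; apply: is_cokernelI => // W h hf0.
apply: (cokernel_desc (epi_cok_ker ge)); apply: le.
by rewrite -cmpA ker_liftE hf0 cmp0m.
Qed.

End AbelianTheory.

(* Abelian categories with enough projectives. *)
Record abelianEP := AbelianEP {
  abcat :> abelian;
  epP : enough_projectives abcat }.

Section Resolutions.
Variable C : abelianEP.
Implicit Types A B : C.

Record resolution A := Resolution {
  res : nat -> C;
  resd : forall n, hom (res n.+1) (res n);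
  aug : hom (res 0) A;
  res_proj : forall n, projective (res n);
  aug_epi : epi aug;
  res_exact0 : exact (resd 0) aug;
  res_exact : forall n, exact (resd n.+1) (resd n) }.

Definition cover A : C := projT1 (cid (epP A)).

Definition cov A : hom (cover A) A := projT1 (cid (projT2 (cid (epP A)))).

Lemma coverP A : projective (cover A) /\ epi (cov A).
Proof. exact: projT2 (cid (projT2 (cid (epP A)))). Qed.

Definition syz A : C := Ker (cov A).

Definition std_res A (n : nat) : C := cover (iter n syz A).

Definition std_resd A (n : nat) : hom (std_res A n.+1) (std_res A n) :=
  ker_map (cov (iter n syz A)) \c cov (iter n.+1 syz A).

Lemma std_res_exact0 A : exact (std_resd A 0) (cov A).
Proof. exact: (exactI (kermP (kers (cov A))) erefl (coverP _).2). Qed.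

Lemma std_res_exact A n : exact (std_resd A n.+1) (std_resd A n).
Proof.
set c := cov (iter n.+1 syz A).
apply: (@exactI _ _ _ _ _ _ _ (ker_map c) (cov (iter n.+2 syz A))) => //;
  last exact: (coverP _).2.
have kc := kermP (kers c); apply: is_kernelI.
- by rewrite -cmpA kc.1 cmpm0.
- exact: kernel_mono kc.
move=> W h e; apply: (kernel_lift kc).
apply: (kernel_mono (kermP (kers (cov (iter n syz A))))).
by rewrite cmpA e cmpm0.
Qed.

Definition std_resolution A : resolution A :=
  {| res_proj := fun n => (coverP _).1;
     aug_epi := (coverP _).2;
     res_exact0 := std_res_exact0 A;
     res_exact := std_res_exact A |}.

End Resolutions.

(* ker b / im a, for U -a-> V -b-> W with b o a = 0. *)
Section Cohomology.
Variables (U V W : zmodType) (a : {additive U -> V}) (b : {additive V -> W}).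

Definition cocycle_pred := fun x : V => b x == 0.

Record cocycle := Cocycle { cocycle_val :> V; _ : cocycle_pred cocycle_val }.

HB.instance Definition _ := [isSub for cocycle_val].
HB.instance Definition _ := [Choice of cocycle by <:].

Fact cocycle_zmod : zmod_closed cocycle_pred.
Proof.
split=> [|x y]; rewrite !unfold_in /cocycle_pred ?raddf0 //.
by move=> /eqP bx /eqP by_; rewrite raddfB bx by_ subrr.
Qed.

HB.instance Definition _ := GRing.isZmodClosed.Build V cocycle_pred cocycle_zmod.
HB.instance Definition _ := [SubChoice_isSubZmodule of cocycle by <:].

Definition coboundary := fun x : cocycle => `[< exists u, a u = val x >].

Fact coboundary_zmod : zmod_closed coboundary.
Proof.
split=> [|x y]; rewrite !unfold_in /coboundary.
  by apply/asboolP; exists 0; rewrite raddf0.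
move=> /asboolP[u ux] /asboolP[v vy]; apply/asboolP.
by exists (u - v); rewrite raddfB ux vy.
Qed.

HB.instance Definition _ :=
  GRing.isZmodClosed.Build cocycle coboundary coboundary_zmod.

Definition coboundaries : zmodClosed cocycle :=
  GRing.ZmodClosed.clone _ coboundary _.

Definition cohomology : zmodType := Quotient.quot coboundaries.

Lemma cohomology_eq0 : (forall x : cohomology, x = 0) <->
  (forall v : V, b v = 0 -> exists u, a u = v).
Proof.
have eq0 (c : cocycle) :
  (\pi_(Quotient.quot coboundaries) c == 0 :> cohomology)%qT =
    `[< exists u, a u = val c >].
  have -> : (0 : cohomology) = (\pi_(Quotient.quot coboundaries) 0)%qT.
    by rewrite raddf0.
  by rewrite -Quotient.idealrBE subr0.
split=> [h v /eqP bv|h x].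
  by have /eqP := h (\pi_(Quotient.quot coboundaries) (Cocycle bv))%qT;
    rewrite eq0 => /asboolP.
apply/eqP; rewrite -[x]reprK eq0; apply/asboolP; apply: h.
by apply/eqP; case: (repr x).
Qed.
End Cohomology.

Section Ext.
Variable C : abelianEP.
Implicit Types A B : C.

Definition precmp A A' B (d : hom A' A) (f : hom A B) : hom A' B := f \c d.

Fact precmp_zmod_morphism A A' B (d : hom A' A) :
  zmod_morphism (@precmp A A' B d).
Proof. by move=> f g; rewrite /precmp cmpBl. Qed.

HB.instance Definition _ A A' B (d : hom A' A) :=
  GRing.isZmodMorphism.Build _ _ (@precmp A A' B d) (precmp_zmod_morphism d).

(* The cohomology of 0 -> Hom(P_0, B) -> Hom(P_1, B) -> ... in degree n; for
   n = 0 the zero map stands in for the differential out of 0. *)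
Definition Ext_res A (P : resolution A) (n : nat) B : zmodType :=
  if n is m.+1
  then cohomology (@precmp _ _ B (resd P m)) (@precmp _ _ B (resd P m.+1))
  else cohomology (\0 : {additive hom (res P 0) B -> hom (res P 0) B})
                  (@precmp _ _ B (resd P 0)).

(* Up to isomorphism independent of the resolution, so the chosen one serves. *)
Definition Ext (n : nat) A B : zmodType := Ext_res (std_resolution A) n B.

Definition Ext_vanishes n A B : Prop := forall x : Ext n A B, x = 0.

End Ext.

Record functor (C D : precat) := Functor {
  fobj :> C -> D;
  fmap : forall A B, hom A B -> hom (fobj A) (fobj B);
  fmap1 : forall A, fmap (idm A) = idm (fobj A);
  fmapM : forall A B E (g : hom B E) (f : hom A B),
    fmap (g \c f) = fmap g \c fmap f }.

Arguments fmap {C D} _ {A B}.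

Definition additive_functor (C D : precat) (F : functor C D) : Prop :=
  forall (A B : C) (f g : hom A B), fmap F (f + g) = fmap F f + fmap F g.

Definition right_exact (C D : abelian) (F : functor C D) : Prop :=
  forall (A B E : C) (f : hom A B) (g : hom B E), exact f g -> epi g ->
    exact (fmap F f) (fmap F g) /\ epi (fmap F g).

Record rex_functor (C D : abelian) := RexFunctor {
  rex_fun :> functor C D;
  rexD : additive_functor rex_fun;
  rex_exact : right_exact rex_fun }.

Section RexTheory.
Variables (C D : abelian) (F : rex_functor C D).
Implicit Types A B : C.

Lemma rex0 A B : fmap F (0 : hom A B) = 0.
Proof. by apply: (addrI (fmap F 0)); rewrite -rexD !addr0. Qed.

Lemma rexN A B (f : hom A B) : fmap F (- f) = - fmap F f.
Proof. by apply: (addrI (fmap F f)); rewrite -rexD !subrr rex0. Qed.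

Lemma rex_epi A B (e : hom A B) : epi e -> epi (fmap F e).
Proof.
by move=> ee; case: (rex_exact F (cokernel_exact (epi_cok_ker ee)) ee).
Qed.

Lemma rex_cmp0 A B E (g : hom B E) (f : hom A B) :
  g \c f = 0 -> fmap F g \c fmap F f = 0.
Proof. by rewrite -fmapM => ->; rewrite rex0. Qed.

Lemma rex_cokernel A B E (c : hom B E) (f : hom A B) :
  is_cokernel c f -> is_cokernel (fmap F c) (fmap F f).
Proof.
move=> cf; have ce := cokernel_epi cf.
have [Fe Fce] := rex_exact F (cokernel_exact cf) ce.
exact: exact_cokernel.
Qed.

End RexTheory.

Arguments rex_epi {C D} F {A B e}.
Arguments rex_cokernel {C D} F {A B E c f}.

Section LeftDerived.
Variables (C : abelianEP) (D : abelian) (F : rex_functor C D).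

(* The homology of F(P_1) -> F(P_0) -> 0 in degree 0, and of the complex F(P)
   in degree n > 0. *)
Definition Lder_res (A : C) (P : resolution A) (n : nat) : D :=
  if n is m.+1 then homology (rex_cmp0 F (exact_cmp0 (res_exact P m)))
  else Cok (fmap F (resd P 0)).

Definition Lder (n : nat) (A : C) : D := Lder_res (std_resolution A) n.

End LeftDerived.

Section TrivialExtension.
Variables (B : abelian) (F : rex_functor B B).

(* The objects (X, f) of the right trivial extension of B by F. *)
Record tobj := Tobj {
  tcar : B;
  tact : hom (F tcar) tcar;
  tactP : tact \c fmap F tact = 0 }.

Implicit Types X Y Z : tobj.

Definition thom_pred X Y := fun a : hom (tcar X) (tcar Y) =>
  a \c tact X == tact Y \c fmap F a.

Record thom X Y := Thom {
  tmap :> hom (tcar X) (tcar Y);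
  _ : thom_pred tmap }.

HB.instance Definition _ X Y := [isSub for @tmap X Y].
HB.instance Definition _ X Y := [Choice of thom X Y by <:].

Fact thom_zmod X Y : zmod_closed (@thom_pred X Y).
Proof.
split=> [|a b]; rewrite !unfold_in /thom_pred.
  by rewrite cmp0m rex0 cmpm0.
by move=> /eqP ea /eqP eb; rewrite cmpBl ea eb rexD rexN -cmpBr.
Qed.

HB.instance Definition _ X Y :=
  GRing.isZmodClosed.Build _ (@thom_pred X Y) (@thom_zmod X Y).
HB.instance Definition _ X Y := [SubChoice_isSubZmodule of thom X Y by <:].

Lemma tmapP X Y (a : thom X Y) : a \c tact X = tact Y \c fmap F a.
Proof. by apply/eqP; case: a. Qed.

Lemma thom_eq X Y (a b : thom X Y) : tmap a = tmap b -> a = b.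
Proof. exact: val_inj. Qed.

Fact tid_subproof X : thom_pred (X := X) (Y := X) (idm (tcar X)).
Proof. by rewrite /thom_pred fmap1 cmp1m cmpm1. Qed.

Definition tid X : thom X X := Thom (tid_subproof X).

Fact tcmp_subproof X Y Z (b : thom Y Z) (a : thom X Y) :
  thom_pred (X := X) (Y := Z) (tmap b \c tmap a).
Proof. by rewrite /thom_pred -cmpA tmapP cmpA tmapP -cmpA fmapM. Qed.

Definition tcmp X Y Z (b : thom Y Z) (a : thom X Y) : thom X Z :=
  Thom (tcmp_subproof b a).

Fact tcmpA X Y Z W (c : thom Z W) (b : thom Y Z) (a : thom X Y) :
  tcmp c (tcmp b a) = tcmp (tcmp c b) a.
Proof. by apply: thom_eq; rewrite /= cmpA. Qed.

Fact tcmp1m X Y (a : thom X Y) : tcmp (tid Y) a = a.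
Proof. by apply: thom_eq; rewrite /= cmp1m. Qed.

Fact tcmpm1 X Y (a : thom X Y) : tcmp a (tid X) = a.
Proof. by apply: thom_eq; rewrite /= cmpm1. Qed.

Fact tcmpDl X Y Z (b b' : thom Y Z) (a : thom X Y) :
  tcmp (b + b') a = tcmp b a + tcmp b' a.
Proof. by apply: thom_eq; rewrite /= cmpDl. Qed.

Fact tcmpDr X Y Z (b : thom Y Z) (a a' : thom X Y) :
  tcmp b (a + a') = tcmp b a + tcmp b a'.
Proof. by apply: thom_eq; rewrite /= cmpDr. Qed.

Definition triv_precat : precat :=
  @Precat tobj (fun X Y => thom X Y : zmodType) tid tcmp tcmpA tcmp1m tcmpm1
    tcmpDl tcmpDr.

Local Notation T := triv_precat.

Lemma triv_hom_eq (X Y : T) (a b : hom X Y) : tmap a = tmap b -> a = b.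
Proof. exact: (@thom_eq X Y). Qed.

Definition triv_zobj : T :=
  Tobj (cmp0m _ (fmap F (0 : hom (F (zobj B)) (zobj B)))).

Fact triv_zobjP : is_zero triv_zobj.
Proof.
have [h1 h2] := zobjP B.
by split=> W f g; apply: triv_hom_eq; [apply: h1 | apply: h2].
Qed.

Lemma triv_kernelP (K X Y : T) (k : hom K X) (a : hom X Y) :
  is_kernel (tmap k) (tmap a) -> is_kernel k a.
Proof.
move=> ka; have km := kernel_mono ka; apply: is_kernelI.
- by apply: triv_hom_eq; exact: ka.1.
- by move=> W f g /(congr1 (@tmap _ _)) /km e; apply: triv_hom_eq.
move=> W h /(congr1 (@tmap _ _)) ah0.
have [v vE] := kernel_lift ka ah0.
have vP : thom_pred (X := W) (Y := K) v.
  apply/eqP; apply: km; rewrite cmpA vE (tmapP h) -vE fmapM !cmpA.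
  by rewrite (tmapP k).
by exists (Thom vP); apply: triv_hom_eq.
Qed.

Lemma triv_cokernelP (X Y D : T) (c : hom Y D) (a : hom X Y) :
  is_cokernel (tmap c) (tmap a) -> is_cokernel c a.
Proof.
move=> ca; have ce := cokernel_epi ca; apply: is_cokernelI.
- by apply: triv_hom_eq; exact: ca.1.
- by move=> W f g /(congr1 (@tmap _ _)) /ce e; apply: triv_hom_eq.
move=> W h /(congr1 (@tmap _ _)) ha0.
have [v vE] := cokernel_desc ca ha0.
have Fce := rex_epi F ce.
have vP : thom_pred (X := D) (Y := W) v.
  apply/eqP; apply: Fce; rewrite -!cmpA -fmapM vE -(tmapP h) -(tmapP c).
  by rewrite cmpA vE.
by exists (Thom vP); apply: triv_hom_eq.
Qed.

Fact triv_ker_lift (X Y : T) (a : hom X Y) :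
  tmap a \c (tact X \c fmap F (ker_map (tmap a))) = 0.
Proof.
rewrite cmpA tmapP -cmpA -fmapM (kermP (kers (tmap a))).1.
by rewrite rex0 cmpm0.
Qed.

Definition triv_ker_act (X Y : T) (a : hom X Y) :
    {u : hom (F (Ker (tmap a))) (Ker (tmap a)) |
      ker_map (tmap a) \c u = tact X \c fmap F (ker_map (tmap a))} :=
  cid (kernel_lift (kermP (kers (tmap a))) (triv_ker_lift a)).

Fact triv_ker_actP (X Y : T) (a : hom X Y) :
  projT1 (triv_ker_act a) \c fmap F (projT1 (triv_ker_act a)) = 0.
Proof.
case: (triv_ker_act a) => u uE /=.
apply: (kernel_mono (kermP (kers (tmap a)))).
rewrite cmpA uE -cmpA -fmapM uE fmapM cmpA tactP cmp0m cmpm0 //.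
Qed.

Definition triv_ker (X Y : T) (a : hom X Y) : T := Tobj (triv_ker_actP a).

Fact triv_ker_map_subproof (X Y : T) (a : hom X Y) :
  thom_pred (X := triv_ker a) (Y := X) (ker_map (tmap a)).
Proof. by apply/eqP; rewrite /= (projT2 (triv_ker_act a)). Qed.

Definition triv_kernel (X Y : T) (a : hom X Y) : kernel_of a :=
  @KernelOf T X Y a (triv_ker a) (Thom (triv_ker_map_subproof a))
    (triv_kernelP (K := triv_ker a) (k := Thom (triv_ker_map_subproof a))
      (kermP (kers (tmap a)))).

Fact triv_cok_desc (X Y : T) (a : hom X Y) :
  (cok_map (tmap a) \c tact Y) \c fmap F (tmap a) = 0.
Proof. by rewrite -cmpA -tmapP cmpA (cokmP (coks (tmap a))).1 cmp0m. Qed.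

Definition triv_cok_act (X Y : T) (a : hom X Y) :
    {u : hom (F (Cok (tmap a))) (Cok (tmap a)) |
      u \c fmap F (cok_map (tmap a)) = cok_map (tmap a) \c tact Y} :=
  cid (cokernel_desc (rex_cokernel F (cokmP (coks (tmap a))))
                     (triv_cok_desc a)).

Fact triv_cok_actP (X Y : T) (a : hom X Y) :
  projT1 (triv_cok_act a) \c fmap F (projT1 (triv_cok_act a)) = 0.
Proof.
case: (triv_cok_act a) => u uE /=.
apply: (rex_epi F (rex_epi F (cokernel_epi (cokmP (coks (tmap a)))))).
by rewrite -cmpA -fmapM uE fmapM cmpA uE -cmpA tactP cmpm0 cmp0m.
Qed.

Definition triv_cok (X Y : T) (a : hom X Y) : T := Tobj (triv_cok_actP a).

Fact triv_cok_map_subproof (X Y : T) (a : hom X Y) :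
  thom_pred (X := Y) (Y := triv_cok a) (cok_map (tmap a)).
Proof. by apply/eqP; rewrite /= (projT2 (triv_cok_act a)). Qed.

Definition triv_cokernel (X Y : T) (a : hom X Y) : cokernel_of a :=
  @CokernelOf T X Y a (triv_cok a) (Thom (triv_cok_map_subproof a))
    (triv_cokernelP (D := triv_cok a) (c := Thom (triv_cok_map_subproof a))
      (cokmP (coks (tmap a)))).

Section Biproduct.
Variables X Y : T.
Let S := bips (tcar X) (tcar Y).

Definition triv_bip_act : hom (F (bip S)) (bip S) :=
  inj1 S \c tact X \c fmap F (prj1 S) + inj2 S \c tact Y \c fmap F (prj2 S).

Fact triv_bip_actP : triv_bip_act \c fmap F triv_bip_act = 0.
Proof.
have [p1i1 p2i2 p1i2 p2i1 _] := bipP S.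
have e1 : fmap F (prj1 S) \c fmap F triv_bip_act
    = fmap F (tact X) \c fmap F (fmap F (prj1 S)).
  rewrite -!fmapM cmpDr !cmpA p1i1 p1i2 cmp1m !cmp0m addr0 //.
have e2 : fmap F (prj2 S) \c fmap F triv_bip_act
    = fmap F (tact Y) \c fmap F (fmap F (prj2 S)).
  rewrite -!fmapM cmpDr !cmpA p2i2 p2i1 cmp1m !cmp0m add0r //.
rewrite {1}/triv_bip_act cmpDl -!cmpA e1 e2.
by rewrite ![tact _ \c (_ \c _)]cmpA !tactP !cmp0m !cmpm0 addr0.
Qed.

Definition triv_bip : T := Tobj triv_bip_actP.

Fact triv_inj1_subproof : thom_pred (X := X) (Y := triv_bip) (inj1 S).
Proof.
have [p1i1 p2i2 p1i2 p2i1 _] := bipP S.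
apply/eqP; rewrite /= /triv_bip_act cmpDl -!cmpA -!fmapM p1i1 p2i1.
by rewrite fmap1 rex0 !cmpm0 cmpm1 addr0.
Qed.

Fact triv_inj2_subproof : thom_pred (X := Y) (Y := triv_bip) (inj2 S).
Proof.
have [p1i1 p2i2 p1i2 p2i1 _] := bipP S.
apply/eqP; rewrite /= /triv_bip_act cmpDl -!cmpA -!fmapM p1i2 p2i2.
by rewrite fmap1 rex0 !cmpm0 cmpm1 add0r.
Qed.

Fact triv_prj1_subproof : thom_pred (X := triv_bip) (Y := X) (prj1 S).
Proof.
have [p1i1 p2i2 p1i2 p2i1 _] := bipP S.
apply/eqP; rewrite /= /triv_bip_act cmpDr !cmpA p1i1 p1i2.
by rewrite cmp1m !cmp0m addr0.
Qed.

Fact triv_prj2_subproof : thom_pred (X := triv_bip) (Y := Y) (prj2 S).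
Proof.
have [p1i1 p2i2 p1i2 p2i1 _] := bipP S.
apply/eqP; rewrite /= /triv_bip_act cmpDr !cmpA p2i1 p2i2.
by rewrite cmp1m !cmp0m add0r.
Qed.

Fact triv_bipP : @is_biproduct T X Y triv_bip
  (Thom triv_inj1_subproof) (Thom triv_inj2_subproof)
  (Thom triv_prj1_subproof) (Thom triv_prj2_subproof).
Proof. by have [? ? ? ? ?] := bipP S; split; apply: triv_hom_eq. Qed.

Definition triv_biproduct : biproduct_of X Y := BiproductOf triv_bipP.

End Biproduct.

Lemma triv_mono (X Y : T) (m : hom X Y) : mono m -> mono (tmap m).
Proof.
move=> mm; apply: mono0P => W f f0.
have [u <-] := kernel_lift (kermP (kers (tmap m))) f0.
have kP := kermP (triv_kernel m).
have /(congr1 (@tmap _ _)) /= -> : kerm (triv_kernel m) = 0.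
  by apply: mm; rewrite kP.1 cmpm0.
by rewrite cmp0m.
Qed.

Lemma triv_epi (X Y : T) (e : hom X Y) : epi e -> epi (tmap e).
Proof.
move=> ee; apply: epi0P => W f f0.
have [u <-] := cokernel_desc (cokmP (coks (tmap e))) f0.
have cP := cokmP (triv_cokernel e).
have /(congr1 (@tmap _ _)) /= -> : cokm (triv_cokernel e) = 0.
  by apply: ee; rewrite cP.1 cmp0m.
by rewrite cmpm0.
Qed.

Fact triv_mono_normal (X Y : T) (m : hom X Y) : mono m ->
  exists (D : T) (g : hom Y D), is_kernel m g.
Proof.
move=> /triv_mono mm; exists (triv_cok m), (cokm (triv_cokernel m)).
apply: triv_kernelP; exact: mono_ker_cok.
Qed.

Fact triv_epi_normal (X Y : T) (e : hom X Y) : epi e ->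
  exists (D : T) (g : hom D X), is_cokernel e g.
Proof.
move=> /triv_epi ee; exists (triv_ker e), (kerm (triv_kernel e)).
apply: triv_cokernelP; exact: epi_cok_ker.
Qed.

Definition triv_abelian : abelian :=
  @Abelian T triv_zobj triv_zobjP triv_biproduct triv_kernel triv_cokernel
    triv_mono_normal triv_epi_normal.

Section Free.
Variable P : B.
Let S := bips P (F P).

Definition free_act : hom (F (bip S)) (bip S) := inj2 S \c fmap F (prj1 S).

Fact free_actP : free_act \c fmap F free_act = 0.
Proof.
have [_ _ p1i2 _ _] := bipP S.
rewrite -cmpA -fmapM /free_act cmpA p1i2 cmp0m rex0 cmpm0 //.
Qed.

(* The left adjoint of (X, f) |-> X. *)
Definition free : T := Tobj free_actP.

Section Adjunct.
Variables (X : T) (h : hom P (tcar X)).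

Definition free_adj_map : hom (bip S) (tcar X) :=
  h \c prj1 S + tact X \c fmap F h \c prj2 S.

Fact free_adj_subproof : thom_pred (X := free) (Y := X) free_adj_map.
Proof.
have [_ p2i2 p1i2 _ _] := bipP S.
apply/eqP; rewrite /= /free_adj_map /free_act rexD cmpDl cmpDr !fmapM !cmpA.
rewrite tactP !cmp0m addr0.
rewrite -[h \c _ \c _]cmpA p1i2 cmpm0 cmp0m add0r.
by rewrite -[_ \c prj2 S \c _]cmpA p2i2 cmpm1.
Qed.

Definition free_adj : hom free X := Thom free_adj_subproof.

Lemma free_adj_inj1 : tmap free_adj \c inj1 S = h.
Proof.
have [p1i1 _ _ p2i1 _] := bipP S.
by rewrite /= cmpDl -!cmpA p1i1 p2i1 !cmpm0 cmpm1 addr0.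
Qed.

End Adjunct.

Lemma free_hom_eq (X : T) (a b : hom free X) :
  tmap a \c inj1 S = tmap b \c inj1 S -> a = b.
Proof.
have [p1i1 p2i2 p1i2 p2i1 s1] := bipP S; move=> e1.
have i2E (c : hom free X) :
    tmap c \c inj2 S = tact X \c fmap F (tmap c \c inj1 S).
  rewrite fmapM cmpA -tmapP /= -!cmpA -fmapM p1i1 fmap1 cmpm1 //.
apply: triv_hom_eq; rewrite -[tmap a]cmpm1 -[tmap b]cmpm1 -s1 !cmpDr !cmpA.
by rewrite !i2E e1.
Qed.

Lemma free_projective : projective P -> projective free.
Proof.
move=> Pp M N e /triv_epi ee g.
have [h hE] := Pp _ _ _ ee (tmap g \c inj1 S).
by exists (free_adj (X := M) h); apply: free_hom_eq; rewrite /= -cmpA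
  [_ \c inj1 S](free_adj_inj1 (X := M)).
Qed.

Lemma free_adj_epi (X : T) (h : hom P (tcar X)) : epi h -> epi (free_adj h).
Proof.
move=> he W a b /(congr1 (@tmap _ _)) /= e; apply: triv_hom_eq; apply: he.
by rewrite -(free_adj_inj1 h) !cmpA /= e.
Qed.

End Free.

End TrivialExtension.

Arguments free {B} F P.

Fact triv_enough_projectives (B : abelianEP) (F : rex_functor B B) :
  enough_projectives (triv_abelian F).
Proof.
move=> X; have [P [e [Pp ee]]] := epP (tcar X).
exists (free F P), (free_adj e); split; first exact: free_projective.
exact: free_adj_epi.
Qed.

Definition triv_ext (B : abelianEP) (F : rex_functor B B) : abelianEP :=
  AbelianEP (@triv_enough_projectives B F).

Section CotorsionPairs.
Variable C : abelianEP.
Implicit Types S X Y : C -> Prop.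

Definition perp_left S : C -> Prop :=
  fun A => forall B, S B -> Ext_vanishes 1 A B.

Definition perp_right S : C -> Prop :=
  fun A => forall B, S B -> Ext_vanishes 1 B A.

Definition cotorsion_pair X Y : Prop :=
  (forall A, X A <-> perp_left Y A) /\ (forall A, Y A <-> perp_right X A).

Definition complete_pair X Y : Prop := forall A,
  (exists (K D : C) (i : hom K D) (p : hom D A),
     [/\ short_exact i p, X D & Y K]) /\
  (exists (E Q : C) (i : hom A E) (p : hom E Q),
     [/\ short_exact i p, Y E & X Q]).

Definition hereditary_pair X Y : Prop :=
  forall n A B, (0 < n)%N -> X A -> Y B -> Ext_vanishes n A B.

Definition hereditary_complete_cotorsion_pair X Y : Prop :=
  [/\ cotorsion_pair X Y, complete_pair X Y & hereditary_pair X Y].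

End CotorsionPairs.

Definition U_inv (B : abelianEP) (F : rex_functor B B) (Y : B -> Prop) :
    triv_ext F -> Prop :=
  fun X => Y (tcar X).

Arguments U_inv {B} F Y.

(* Main.v *)
From mathcomp Require Import all_boot all_algebra boolp.
Require Import Defs.

(** Write T for the free functor P |-> (P + F P) from B to the trivial
    extension, left adjoint to the exact forgetful functor U, and C for the left
    class.

    - By adjunction T X lies in C for X in X.
    - An X-precover X1 -> U M with kernel Y1 is adjoint to an epimorphism
      T X1 -> M whose kernel is an extension of F X1 by Y1; it therefore lies
      in U^-1(Y). In particular every object of C is a retract of some T X.
    - Let 0 -> U M -> Y0 -> X0 -> 0 be a Y-preenvelope. Since L_1F(X0) = 0, T
      preserves its exactness, and the pushout of 0 -> TUM -> TY0 -> TX0 -> 0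
      along the counit T U M -> M has a middle term which is an extension of
      F X0 by Y0. This is a preenvelope of M, and it splits if M is in the right
      orthogonal of C.
    - If A is a retract of T X, then any syzygy of A is a retract of the sum of
      T (syz X) and a projective, so C is closed under syzygies. *)

Set Implicit Arguments.
Unset Strict Implicit.
Unset Printing Implicit Defensive.

Import GRing.Theory.
Local Open Scope ring_scope.

(** * Kernels, short exact sequences and biproducts in an abelian category *)

Section AbelianFacts.
Variable C : abelian.
Implicit Types A B D : C.

Lemma mono_eq0 A B (m : hom A B) W (f : hom W A) :
  mono m -> m \c f = 0 -> f = 0.
Proof. by move=> mm e; apply: mm; rewrite e cmpm0. Qed.

Lemma epi_eq0 A B (e : hom A B) W (f : hom B W) : epi e -> f \c e = 0 -> f = 0.
Proof. by move=> ee fe; apply: ee; rewrite fe cmp0m. Qed.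

Lemma epi_comp A B D (g : hom B D) (f : hom A B) :
  epi f -> epi g -> epi (g \c f).
Proof. by move=> ef eg W a b; rewrite !cmpA => /ef /eg. Qed.

Lemma epi_compr A B D (g : hom B D) (f : hom A B) : epi (g \c f) -> epi g.
Proof. by move=> e W a b ab; apply: e; rewrite !cmpA ab. Qed.

Lemma retraction_epi A B (r : hom A B) (s : hom B A) : r \c s = idm B -> epi r.
Proof. by move=> rs W a b ab; rewrite -[a]cmpm1 -[b]cmpm1 -rs !cmpA ab. Qed.

Lemma short_exactP A B D (f : hom A B) (g : hom B D) :
  short_exact f g <-> is_kernel f g /\ epi g.
Proof.
split=> [[fm fg ge]|[fg ge]]; last first.
  by split=> //; [exact: kernel_mono fg | apply: (exactI fg (cmpm1 f)) => W a b;
    rewrite !cmpm1].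
split=> //; apply: is_kernelI => // [|W h gh0]; first exact: exact_cmp0.
have [u uE] := cokernel_desc (exact_cokernel fg ge) (cokmP (coks f)).1.
by apply: (kernel_lift (mono_ker_cok fm)); rewrite -uE -cmpA gh0 cmpm0.
Qed.

Lemma split_kernel N E A (n : hom N E) (p : hom E A) (s : hom A E) :
  is_kernel n p -> p \c s = idm A -> exists r : hom E N, r \c n = idm N.
Proof.
move=> np ps; have [|r rE] := @kernel_lift _ _ _ _ _ _ _ (idm E - s \c p) np.
  by rewrite cmpBr cmpA ps cmp1m cmpm1 subrr.
exists r; apply: (kernel_mono np).
by rewrite cmpA rE cmpBl -cmpA np.1 cmpm0 subr0 cmp1m cmpm1.
Qed.

Definition in1 A B := inj1 (bips A B).
Definition in2 A B := inj2 (bips A B).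
Definition pr1 A B := prj1 (bips A B).
Definition pr2 A B := prj2 (bips A B).

(** A rewriting multirule; the last four equations are the first four precomposed with [x], for
    right-nested composites. *)
Lemma sumE A B :
  (((@pr1 A B \c @in1 A B = idm A) * (@pr2 A B \c @in2 A B = idm B)
  * (@pr1 A B \c @in2 A B = 0) * (@pr2 A B \c @in1 A B = 0))
  * ((forall W (x : hom W A), @pr1 A B \c (@in1 A B \c x) = x)
  * (forall W (x : hom W B), @pr2 A B \c (@in2 A B \c x) = x)
  * (forall W (x : hom W B), @pr1 A B \c (@in2 A B \c x) = 0)
  * (forall W (x : hom W A), @pr2 A B \c (@in1 A B \c x) = 0)))%type.
Proof.
rewrite /pr1 /pr2 /in1 /in2; have [r1s1 r2s2 r1s2 r2s1 _] := bipP (bips A B).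
split=> //; do 3?split; move=> W x;
  by rewrite cmpA ?(r1s1, r2s2, r1s2, r2s1) ?cmp1m ?cmp0m.
Qed.

Lemma sum_eq A B W (x y : hom W (bip (bips A B))) :
  @pr1 A B \c x = @pr1 A B \c y -> @pr2 A B \c x = @pr2 A B \c y -> x = y.
Proof.
have [_ _ _ _ e] := bipP (bips A B); rewrite /pr1 /pr2 => e1 e2.
by rewrite -[x]cmp1m -[y]cmp1m -e !cmpDl -!cmpA e1 e2.
Qed.

Definition sum_map A B A' B' (f : hom A A') (g : hom B B') :
    hom (bip (bips A B)) (bip (bips A' B')) :=
  in1 A' B' \c (f \c pr1 A B) + in2 A' B' \c (g \c pr2 A B).

Section SumMap.
Variables (A B A' B' : C) (f : hom A A') (g : hom B B').

Lemma pr1_sum_map : pr1 A' B' \c sum_map f g = f \c pr1 A B.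
Proof. by rewrite cmpDr !sumE addr0. Qed.

Lemma pr2_sum_map : pr2 A' B' \c sum_map f g = g \c pr2 A B.
Proof. by rewrite cmpDr !sumE add0r. Qed.

Lemma sum_map_in1 : sum_map f g \c in1 A B = in1 A' B' \c f.
Proof. by rewrite cmpDl -!cmpA !sumE cmpm1 !cmpm0 addr0. Qed.

Lemma sum_map_in2 : sum_map f g \c in2 A B = in2 A' B' \c g.
Proof. by rewrite cmpDl -!cmpA !sumE cmpm1 !cmpm0 add0r. Qed.

Lemma sum_map_epi : epi f -> epi g -> epi (sum_map f g).
Proof.
move=> fe ge W x y xy; have [_ _ _ _ e] := bipP (bips A' B').
have e1 : x \c in1 A' B' = y \c in1 A' B'.
  by apply: fe; rewrite -!cmpA -sum_map_in1 !cmpA xy.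
have e2 : x \c in2 A' B' = y \c in2 A' B'.
  by apply: ge; rewrite -!cmpA -sum_map_in2 !cmpA xy.
by rewrite -[x]cmpm1 -[y]cmpm1 -e !cmpDr !cmpA e1 e2.
Qed.

End SumMap.

Lemma sum_map_kernel A B A' B' D D' (f : hom A A') (g : hom B B')
    (q : hom A' D) (q' : hom B' D') :
  is_kernel f q -> is_kernel g q' -> is_kernel (sum_map f g) (sum_map q q').
Proof.
move=> fq gq; apply: is_kernelI => [||W h h0].
- apply: sum_eq; rewrite cmpm0 cmpA ?pr1_sum_map ?pr2_sum_map -cmpA.
    by rewrite pr1_sum_map cmpA fq.1 cmp0m.
  by rewrite pr2_sum_map cmpA gq.1 cmp0m.
- apply: mono0P => W x x0; apply: sum_eq; rewrite cmpm0.
    apply: (mono_eq0 (kernel_mono fq)).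
    by rewrite cmpA -(pr1_sum_map f g) -cmpA x0 cmpm0.
  apply: (mono_eq0 (kernel_mono gq)).
  by rewrite cmpA -(pr2_sum_map f g) -cmpA x0 cmpm0.
have [|a aE] := @kernel_lift _ _ _ _ _ _ _ (pr1 A' B' \c h) fq.
  by rewrite cmpA -(pr1_sum_map q q') -cmpA h0 cmpm0.
have [|b bE] := @kernel_lift _ _ _ _ _ _ _ (pr2 A' B' \c h) gq.
  by rewrite cmpA -(pr2_sum_map q q') -cmpA h0 cmpm0.
exists (in1 A B \c a + in2 A B \c b).
apply: sum_eq; rewrite cmpA ?pr1_sum_map ?pr2_sum_map -cmpA cmpDr !sumE.
  by rewrite addr0.
by rewrite add0r.
Qed.

End AbelianFacts.

Arguments in1 {C}.
Arguments in2 {C}.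
Arguments pr1 {C}.
Arguments pr2 {C}.

(** * Diagram chasing with maps out of projectives *)

Section ProjectiveTests.
Variable C : abelianEP.
Implicit Types A B D : C.

(** Maps out of projectives serve as elements: they detect zero, because covers are epi, and they
    lift along epimorphisms. *)
Lemma mono_proj A B (m : hom A B) :
  (forall Q, projective Q -> forall x : hom Q A, m \c x = 0 -> x = 0) -> mono m.
Proof.
move=> h; apply: mono0P => W f mf0; apply: (epi_eq0 (coverP W).2).
by apply: (h _ (coverP W).1); rewrite cmpA mf0 cmp0m.
Qed.

Lemma epi_proj A B (e : hom A B) :
  (forall Q, projective Q -> forall x : hom Q B, exists y, e \c y = x) -> epi e.
Proof.
move=> h; have [y yE] := h _ (coverP B).1 (cov B).
by apply: (@epi_compr _ _ _ _ _ y); rewrite yE; exact: (coverP B).2.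
Qed.

Lemma is_kernel_proj A B D (f : hom A B) (g : hom B D) :
    g \c f = 0 -> mono f ->
    (forall Q, projective Q -> forall x : hom Q B, g \c x = 0 ->
      exists y, f \c y = x) ->
  is_kernel f g.
Proof.
move=> gf0 fm h; apply: is_kernelI => // W x gx0.
have [|y yE] := h _ (coverP W).1 (x \c cov W).
  by rewrite cmpA gx0 cmp0m.
apply: (kernel_lift (mono_ker_cok fm)); apply: (epi_eq0 (coverP W).2).
by rewrite -cmpA -yE cmpA (cokmP (coks f)).1 cmp0m.
Qed.

Lemma exact_lift A B D (f : hom A B) (g : hom B D) Q (x : hom Q B) :
  projective Q -> exact f g -> g \c x = 0 -> exists y, f \c y = x.
Proof.
move=> Qp [gf0 le] gx0; have [u <-] := kernel_lift (kermP (kers g)) gx0.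
have [v <-] := Qp _ _ _ le u.
by exists v; rewrite cmpA ker_liftE.
Qed.

(** The pushout is the cokernel [c] of [phi = (h, - i)]. Since [i] is mono, so is [phi], which is
    therefore the kernel of [c]. *)
Lemma pushout_short_exact A B D A' (i : hom A B) (p : hom B D) (h : hom A A') :
    is_kernel i p -> epi p ->
  exists (E : C) (i' : hom A' E) (p' : hom E D) (k : hom B E),
    [/\ is_kernel i' p', epi p', k \c i = i' \c h & p' \c k = p].
Proof.
move=> ip pe; have im := kernel_mono ip.
pose phi := in1 A' B \c h - in2 A' B \c i.
have r1phi : pr1 A' B \c phi = h by rewrite cmpBr !sumE subr0.
have r2phi : pr2 A' B \c phi = - i by rewrite cmpBr !sumE sub0r.
have phim : mono phi.
  apply: mono0P => W f e; apply: (mono_eq0 im); apply: oppr_inj.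
  by rewrite oppr0 -cmpNl -r2phi -cmpA e cmpm0.
pose c := cok_map phi; have cP : is_cokernel c phi := cokmP (coks phi).
have phic : is_kernel phi c := mono_ker_cok phim.
have ce : epi c := cokernel_epi cP.
have [|p' p'E] := @cokernel_desc _ _ _ _ _ _ _ (p \c pr2 A' B) cP.
  by rewrite -cmpA r2phi cmpNr ip.1 oppr0.
have p'k : p' \c (c \c in2 A' B) = p by rewrite cmpA p'E -cmpA sumE cmpm1.
have ki : (c \c in2 A' B) \c i = (c \c in1 A' B) \c h.
  by apply/esym/eqP; rewrite -subr_eq0 -!cmpA -cmpBr cP.1.
have p'i' : p' \c (c \c in1 A' B) = 0 by rewrite cmpA p'E -cmpA sumE cmpm0.
exists (Cok phi), (c \c in1 A' B), p', (c \c in2 A' B); split=> //.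
- apply: is_kernel_proj => // [|Q Qp x p'x].
    apply: mono0P => W a; rewrite -cmpA => /(kernel_lift phic) [b bE].
    have b0 : b = 0.
      apply: (mono_eq0 im); apply: oppr_inj.
      by rewrite oppr0 -cmpNl -r2phi -cmpA bE sumE.
    by rewrite -[a](sumE _ B) -bE b0 !cmpm0.
  have [y yE] := Qp _ _ _ ce x.
  have [|a aE] := @kernel_lift _ _ _ _ _ _ _ (pr2 A' B \c y) ip.
    by rewrite cmpA -p'E -cmpA yE.
  (* The [B]-component of [y] is [i \c a], so adding [phi \c a] moves [y] into [A'] without changing
     its image under [c]. *)
  exists (pr1 A' B \c y + h \c a).
  rewrite cmpDr [_ \c (h \c a)]cmpA -ki -!cmpA aE -cmpDr -[in RHS]yE.
  by congr (c \c _); apply: sum_eq; rewrite cmpDr !sumE ?addr0 ?add0r.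
- by apply: (@epi_compr _ _ _ _ _ (c \c in2 A' B)); rewrite p'k.
Qed.

End ProjectiveTests.

(** * Vanishing of Ext in terms of syzygies and liftings *)

Section ExtVanishing.
Variable C : abelianEP.
Implicit Types A B D N : C.

(** A 1-cocycle is a map from the cover of [syz A] that descends to [syz A]; it is a coboundary when
    the descended map extends to [cover A]. *)
Lemma Ext1P A N : Ext_vanishes 1 A N <->
  forall w : hom (syz A) N, exists u, u \c ker_map (cov A) = w.
Proof.
have c1e : epi (cov (syz A)) := (coverP _).2.
split=> [/cohomology_eq0 h w|h].
  have [|u uE] := h (w \c cov (syz A)).
    rewrite /= /precmp /std_resd /= -cmpA [cov _ \c _]cmpA.
    by rewrite (kermP (kers (cov (syz A)))).1 cmp0m cmpm0.
  by exists u; apply: c1e; rewrite -cmpA -[RHS]uE.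
apply/cohomology_eq0 => v; rewrite /= /precmp /std_resd /= cmpA => v0.
have [|w wE] := @cokernel_desc _ _ _ _ _ _ _ v (epi_cok_ker c1e).
  by apply: (epi_eq0 (coverP _).2).
have [u uE] := h w; exists u; rewrite cmpA.
by have -> : u \c ker_map (cov A) = w by [].
Qed.

(** A lift of [g \c cov A] through [p] sends [syz A] into [N]; subtracting an extension of this
    restriction makes it descend to [A]. Conversely, lifting [idm A] splits the pushout of the
    syzygy sequence along [w], and the retraction extends [w]. *)
Lemma Ext1_lift A N : Ext_vanishes 1 A N <->
  forall E Z (n : hom N E) (p : hom E Z), is_kernel n p -> epi p ->
    forall g : hom A Z, exists g', p \c g' = g.
Proof.
have ce : epi (cov A) := (coverP A).2.
have kc := kermP (kers (cov A)).
split=> [/Ext1P h E Z n p np pe g|h].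
  have [g0 g0E] := (coverP A).1 _ _ _ pe (g \c cov A).
  have [|w wE] := @kernel_lift _ _ _ _ _ _ _ (g0 \c ker_map (cov A)) np.
    by rewrite cmpA g0E -cmpA kc.1 cmpm0.
  have [u uE] := h w.
  have [|g' g'E] := @cokernel_desc _ _ _ _ _ _ _ (g0 - n \c u) (epi_cok_ker ce).
    by rewrite cmpBl -cmpA uE wE subrr.
  exists g'; apply: ce.
  by rewrite -cmpA g'E cmpBr cmpA np.1 cmp0m subr0.
apply/Ext1P => w.
have [E [i' [p' [k [i'p' p'e ki p'k]]]]] := pushout_short_exact w kc ce.
have [s sE] := h _ _ _ _ i'p' p'e (idm A).
have [r rE] := split_kernel i'p' sE.
by exists (r \c k); rewrite -cmpA ki cmpA rE cmp1m.
Qed.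

Lemma Ext1_extension A N1 N N2 (i : hom N1 N) (p : hom N N2) :
    is_kernel i p -> epi p ->
    Ext_vanishes 1 A N1 -> Ext_vanishes 1 A N2 ->
  Ext_vanishes 1 A N.
Proof.
move=> ip pe /Ext1P h1 /Ext1P h2; apply/Ext1P => w.
have [u uE] := h2 (p \c w).
have [u' u'E] := (coverP A).1 _ _ _ pe u.
have [|w' w'E] := @kernel_lift _ _ _ _ _ _ _ (w - u' \c ker_map (cov A)) ip.
  by rewrite cmpBr cmpA u'E uE subrr.
have [v vE] := h1 w'.
by exists (u' + i \c v); rewrite cmpDl -cmpA vE w'E addrC subrK.
Qed.

Lemma Ext1_retract A N R (s : hom R N) (r : hom N R) : r \c s = idm R ->
  Ext_vanishes 1 A N -> Ext_vanishes 1 A R.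
Proof.
move=> rs /Ext1P h; apply/Ext1P => w; have [u uE] := h (s \c w).
by exists (r \c u); rewrite -cmpA uE cmpA rs cmp1m.
Qed.

(* The identity of syz A differs from S -> K -> S by an endomorphism factoring
   through the projective cover A. *)
Lemma Ext1_syz_retract A D K P N (s : hom A D) (r : hom D A)
    (i : hom K P) (p : hom P D) :
    r \c s = idm A -> projective P -> is_kernel i p -> epi p ->
    Ext_vanishes 1 K N ->
  Ext_vanishes 1 (syz A) N.
Proof.
move=> rs Pp ip pe /Ext1_lift h; apply/Ext1_lift => E Z n q nq qe g.
have [Qp ce] := coverP A; have kc := kermP (kers (cov A)).
pose k := ker_map (cov A).
have [s0 s0E] := Qp _ _ _ pe (s \c cov A).
have [r0 r0E] := Pp _ _ _ ce (r \c p).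
have [|s1 s1E] := @kernel_lift _ _ _ _ _ _ _ (s0 \c k) ip.
  by rewrite cmpA s0E -cmpA kc.1 cmpm0.
have [|r1 r1E] := @kernel_lift _ _ _ _ _ _ _ (r0 \c i) kc.
  by rewrite cmpA r0E -cmpA ip.1 cmpm0.
(* Both [r0 \c s0] and the identity lie over [cov A], so they differ by a map into [syz A]. *)
have [|t tE] := @kernel_lift _ _ _ _ _ _ _ (r0 \c s0 - idm _) kc.
  by rewrite cmpBr cmpA r0E -cmpA s0E cmpA rs cmp1m cmpm1 subrr.
have idE : r1 \c s1 - t \c k = idm (syz A).
  apply: (kernel_mono kc); rewrite cmpBr !cmpA r1E tE -cmpA s1E cmpBl cmp1m.
  by rewrite cmpA subKr cmpm1.
have [a aE] := h _ _ _ _ nq qe (g \c r1).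
have [b bE] := Qp _ _ _ qe (g \c t).
exists (a \c s1 - b \c k).
by rewrite cmpBr !cmpA aE bE -!cmpA -cmpBr idE cmpm1.
Qed.

(** Dimension shifting holds by conversion: degrees [n] to [n + 2] of the standard resolution of [A]
    are the start of that of its [n]-th syzygy. *)
Lemma Ext_syz n A N :
  Ext_vanishes n.+1 A N <-> Ext_vanishes 1 (iter n (@syz C) A) N.
Proof. by []. Qed.

End ExtVanishing.

(** * Monomorphisms preserved when the first left derived functor vanishes *)

Section LeftDerivedVanishing.
Variables (C D : abelianEP) (F : rex_functor C D).

(** The syzygy sequence comes first: an element of F(syz A) killed in F(cover A) lifts to a 1-cycle
    of the complex F(P), which is a boundary and so dies in F(syz A). The general sequence is a
    quotient of this one by a pushout. *)
Lemma Lder1_mono M N A (j : hom M N) (q : hom N A) :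
  is_zero (Lder F 1 A) -> is_kernel j q -> epi q -> mono (fmap F j).
Proof.
move=> [_ L0] jq qe.
have Fex : exact (fmap F (std_resd A 1)) (fmap F (std_resd A 0)).
  exists (rex_cmp0 F (exact_cmp0 (res_exact (std_resolution A) 0))).
  apply: epi0P => W f f0.
  have [u <-] := cokernel_desc (cokmP (coks _)) f0.
  by rewrite (L0 _ u 0) cmp0m.
pose k := ker_map (cov A).
have kc : is_kernel k (cov A) := kermP (kers (cov A)).
have [Pp ce] := coverP A.
have Fkm : mono (fmap F k).
  apply: mono_proj => Q Qp x Fkx0.
  have [y yE] := Qp _ _ _ (rex_epi F (coverP (syz A)).2) x.
  have [|z zE] := @exact_lift _ _ _ _ _ _ _ y Qp Fex.
    by rewrite /std_resd fmapM -cmpA yE.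
  rewrite -yE -zE cmpA -fmapM /std_resd cmpA.
  by rewrite (kermP (kers (cov (syz A)))).1 cmp0m rex0 cmp0m.
have [g gE] := Pp _ _ _ qe (cov A).
have [|w wE] := @kernel_lift _ _ _ _ _ _ _ (g \c k) jq.
  by rewrite cmpA gE kc.1.
(* N is the pushout of cover A <- syz A -> M, and F preserves it. *)
pose S1 := in1 M (cover A); pose S2 := in2 M (cover A).
pose R1 := pr1 M (cover A); pose R2 := pr2 M (cover A).
pose phi := S1 \c w - S2 \c k; pose c := j \c R1 + g \c R2.
have ce' : epi c.
  apply: epi_proj => Q Qp x; have [y yE] := Qp _ _ _ ce (q \c x).
  have [|m mE] := @kernel_lift _ _ _ _ _ _ _ (x - g \c y) jq.
    by rewrite cmpBr cmpA gE yE subrr.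
  exists (S1 \c m + S2 \c y).
  by rewrite cmpDl !cmpDr -!cmpA !sumE !cmpm0 addr0 add0r mE subrK.
have r1phi : R1 \c phi = w by rewrite cmpBr !sumE subr0.
have r2phi : R2 \c phi = - k by rewrite cmpBr !sumE sub0r.
have phic : is_kernel phi c.
  apply: is_kernelI => [||W h].
  - by rewrite cmpDl -!cmpA r1phi r2phi cmpNr wE subrr.
  - apply: mono0P => W f e; apply: (mono_eq0 (kernel_mono kc)).
    by apply: oppr_inj; rewrite oppr0 -cmpNl -r2phi -cmpA e cmpm0.
  rewrite cmpDl -!cmpA => ch0.
  have [|t tE] := @kernel_lift _ _ _ _ _ _ _ (R2 \c h) kc.
    rewrite -gE -cmpA; move/(congr1 (cmp q)): ch0.
    by rewrite cmpDr cmpm0 [q \c (j \c _)]cmpA jq.1 cmp0m add0r.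
  exists (- t); apply: sum_eq; rewrite -/R1 -/R2 cmpA ?r1phi ?r2phi cmpNr.
    apply: (kernel_mono jq); apply/esym/eqP; rewrite cmpNr -addr_eq0.
    by rewrite [j \c (w \c t)]cmpA wE -[g \c _ \c t]cmpA tE ch0.
  by rewrite cmpNl opprK.
have [_ exphi _] := (short_exactP phi c).2 (conj phic ce').
apply: mono_proj => Q Qp x Fjx0.
(* The element [(x, 0)] is killed by [fmap F c], hence comes from some [z]; its zero second
   component gives [fmap F k \c z = 0]. *)
have [|z zE] := @exact_lift _ _ _ _ _ _ _ (fmap F S1 \c x) Qp
                  (rex_exact F exphi ce').1.
  by rewrite cmpA -fmapM cmpDl -!cmpA !sumE cmpm0 addr0 cmpm1.
have z0 : z = 0.
  apply: (mono_eq0 Fkm); apply: oppr_inj.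
  rewrite oppr0 -cmpNl -rexN -r2phi fmapM -cmpA zE cmpA -fmapM.
  by rewrite sumE rex0 cmp0m.
have <- : fmap F R1 \c (fmap F S1 \c x) = x.
  by rewrite cmpA -fmapM sumE fmap1 cmp1m.
by rewrite -zE z0 !cmpm0.
Qed.

End LeftDerivedVanishing.

(** * The free functor and extensions in the trivial extension *)

Section TrivialExtensionFacts.
Variables (B : abelianEP) (F : rex_functor B B).
Local Notation T := (triv_ext F).

Lemma triv_kernel_tmap (K M N : T) (k : hom K M) (a : hom M N) :
  is_kernel k a -> is_kernel (tmap k) (tmap a).
Proof.
move=> ka; apply: is_kernelI => [||W h ah0].
- by have /(congr1 (@tmap _ _ _ _)) := ka.1.
- exact: triv_mono (kernel_mono ka).
have [v vE] := kernel_lift ka (kermP (triv_kernel a)).1.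
have [u uE] := kernel_lift (kermP (kers (tmap a))) ah0.
exists (tmap v \c u); rewrite cmpA -[RHS]uE.
by have /(congr1 (@tmap _ _ _ _)) /= -> := vE.
Qed.

Lemma triv_epi_tmap (M N : T) (e : hom M N) : epi (tmap e) -> epi e.
Proof.
move=> ee W a b /(congr1 (@tmap _ _ _ _)) /= ab.
by apply: triv_hom_eq; exact: ee.
Qed.

(** Lifting a map out of [free F A] amounts, by adjunction, to lifting its restriction to [A] in the
    underlying sequence. *)
Lemma perp_left_free (Y : B -> Prop) (A : B) :
  perp_left Y A -> perp_left (U_inv F Y) (free F A : T).
Proof.
move=> h N /h /Ext1_lift hN; apply/Ext1_lift => E Z n p np pe g.
have [x xE] := hN _ _ _ _ (triv_kernel_tmap np) (triv_epi pe)
                 (tmap g \c in1 A (F A)).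
exists (free_adj (X := E) x); apply: free_hom_eq.
by rewrite /= -cmpA -/(tmap (free_adj x)) free_adj_inj1.
Qed.

(** The free functor on morphisms; going through the adjunction gives compatibility with the
    actions. *)
Definition free_map (M N : B) (j : hom M N) : hom (free F M : T) (free F N) :=
  free_adj (X := free F N) (in1 N (F N) \c j).

Lemma free_mapE (M N : B) (j : hom M N) :
  tmap (free_map j) = sum_map j (fmap F j).
Proof.
rewrite /= /free_adj_map /= /free_act -!cmpA; congr (_ + _ \c _).
by rewrite !cmpA -fmapM cmpA; congr (fmap F _ \c _); rewrite -cmpA sumE.
Qed.

(** The underlying sequence is the direct sum of the given one and its image under [F]. *)
Lemma free_map_short_exact (M N A : B) (j : hom M N) (q : hom N A) :
  is_zero (Lder F 1 A) -> is_kernel j q -> epi q ->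
  is_kernel (free_map j) (free_map q) /\ epi (free_map q).
Proof.
move=> L0 jq qe; have Fjm := Lder1_mono L0 jq qe.
have [_ jqex _] : short_exact j q by apply/short_exactP.
have [Fex Fqe] := rex_exact F jqex qe.
have [Fjq _] : is_kernel (fmap F j) (fmap F q) /\ epi (fmap F q).
  by apply/short_exactP.
split.
  by apply: triv_kernelP; rewrite !free_mapE; exact: sum_map_kernel.
by apply: triv_epi_tmap; rewrite free_mapE; exact: sum_map_epi.
Qed.

(** [K] consists of the pairs [(b, x)] in A + F A with [a b + tact M (F a) x = 0]. Those with
    [x = 0] form [N], and every [x] occurs because [a] is epi. *)
Lemma adj_kernel_extension (K M : T) (A N : B) (i : hom N A)
    (a : hom A (tcar M)) (k : hom K (free F A : T)) :
    is_kernel i a -> epi a -> is_kernel k (free_adj a) ->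
  exists (y : hom N (tcar K)) (z : hom (tcar K) (F A)), is_kernel y z /\ epi z.
Proof.
move=> ia ae /triv_kernel_tmap /= ka; have km := kernel_mono ka.
have [|y yE] := @kernel_lift _ _ _ _ _ _ _ (in1 A (F A) \c i) ka.
  by rewrite cmpA free_adj_inj1 ia.1.
exists y, (pr2 A (F A) \c tmap k); split.
  apply: is_kernelI => [||W h h0].
  - by rewrite -cmpA yE sumE.
  - apply: mono0P => W x x0; apply: (mono_eq0 (kernel_mono ia)).
    rewrite -[i](sumE A (F A)) -yE -!cmpA x0 !cmpm0 //.
  have khE : in1 A (F A) \c (pr1 A (F A) \c (tmap k \c h)) = tmap k \c h.
    by apply: sum_eq; rewrite !sumE // cmpA h0.
  have [|x xE] := @kernel_lift _ _ _ _ _ _ _ (pr1 A (F A) \c (tmap k \c h)) ia.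
    by rewrite -(free_adj_inj1 a) -cmpA khE cmpA ka.1 cmp0m.
  by exists x; apply: km; rewrite cmpA yE -cmpA xE khE.
apply: epi_proj => Q Qp x.
have [b bE] := Qp _ _ _ ae (- (tact M \c fmap F a \c x)).
have [|u uE] := @kernel_lift _ _ _ _ _ _ _
                  (in1 A (F A) \c b + in2 A (F A) \c x) ka.
  rewrite cmpDr cmpA free_adj_inj1 bE /= /free_adj_map cmpDl -!cmpA !sumE.
  by rewrite cmpm0 add0r addNr.
by exists u; rewrite -cmpA uE cmpDr !sumE add0r.
Qed.

(** The kernel of E -> A + F A -> F A is an extension of [A] by [M]. The restriction [y] of [k] to
    [N] identifies it with [N], since [y \c j] is [i] and [y] lies over [q]. *)
Lemma free_pushout_extension (M E : T) (N A : B) (j : hom (tcar M) N)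
    (q : hom N A) (i : hom M E) (p : hom E (free F A : T))
    (k : hom (free F N : T) E) :
    is_kernel j q -> epi q -> is_kernel i p -> epi p ->
    k \c free_map j = i \c free_adj (idm (tcar M)) -> p \c k = free_map q ->
  exists (y : hom N (tcar E)) (z : hom (tcar E) (F A)), is_kernel y z /\ epi z.
Proof.
move=> jq qe /triv_kernel_tmap ip /triv_epi pe.
move=> /(congr1 (@tmap _ _ _ _)) kj /(congr1 (@tmap _ _ _ _)) pk.
have {}kj : tmap k \c sum_map j (fmap F j)
    = tmap i \c tmap (free_adj (idm (tcar M))).
  by rewrite -free_mapE.
have {}pk : tmap p \c tmap k = sum_map q (fmap F q) by rewrite -free_mapE.
have im := kernel_mono ip.
pose y := tmap k \c in1 N (F N).
have yj : y \c j = tmap i.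
  rewrite -cmpA -(sum_map_in1 j (fmap F j)) cmpA kj -cmpA.
  by rewrite free_adj_inj1 cmpm1.
have py : tmap p \c y = in1 A (F A) \c q.
  by rewrite cmpA pk sum_map_in1.
exists y, (pr2 A (F A) \c tmap p); split; last first.
  apply: epi_comp => //.
  by apply: (@retraction_epi _ _ _ _ (in2 _ _)); rewrite sumE.
apply: is_kernel_proj => [||Q Qp e e0].
- by rewrite -cmpA py sumE.
- apply: mono0P => W x yx0.
  have [|x' x'E] := @kernel_lift _ _ _ _ _ _ _ x jq.
    have := congr1 (cmp (pr1 A (F A) \c tmap p)) yx0.
    by rewrite cmpm0 -cmpA [tmap p \c _]cmpA py -!cmpA !sumE.
  move: yx0; rewrite -x'E cmpA yj => /(mono_eq0 im) ->.
  by rewrite cmpm0.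
have [x xE] := Qp _ _ _ qe (pr1 A (F A) \c (tmap p \c e)).
have [|m mE] := @kernel_lift _ _ _ _ _ _ _ (e - y \c x) ip.
  rewrite cmpBr cmpA py; apply/eqP; rewrite subr_eq0; apply/eqP.
  by apply: sum_eq; rewrite -cmpA !sumE ?xE // cmpA e0.
by exists (x + j \c m); rewrite cmpDr [y \c (j \c m)]cmpA yj mE addrC subrK.
Qed.

End TrivialExtensionFacts.

(** * The induced cotorsion pair *)

Theorem theoremB (B : abelianEP) (enough_inj : enough_injectives B)
    (F : rex_functor B B) (X Y : B -> Prop)
    (hXY : hereditary_complete_cotorsion_pair X Y)
    (L1FX : forall A : B, X A -> is_zero (Lder F 1 A))
    (FXY : forall A : B, X A -> Y (F A)) :
  hereditary_complete_cotorsion_pair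
    (perp_left (U_inv F Y)) (U_inv F Y).
Proof.
have [[XP YP] XYc XYh] := hXY.
have Yext (N1 N N2 : B) (i : hom N1 N) (p : hom N N2) :
    is_kernel i p /\ epi p -> Y N1 -> Y N2 -> Y N.
  move=> [ip pe] /YP Y1 /YP Y2; apply/YP => A XA.
  by apply: (Ext1_extension ip pe); [exact: Y1 | exact: Y2].
have freeX (A : B) : X A -> perp_left (U_inv F Y) (free F A : triv_ext F).
  by move=> /XP; exact: perp_left_free.
have precover (M : triv_ext F) :
    exists (K : triv_ext F) (A : B) (i : hom K (free F A : triv_ext F))
      (p : hom (free F A : triv_ext F) M),
      [/\ is_kernel i p, epi p, X A & U_inv F Y K].
  have [[N [A [i [a [/short_exactP[ia ae] XA YN]]]]] _] := XYc (tcar M).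
  pose k := ker_map (free_adj a : hom (free F A : triv_ext F) M).
  have kP : is_kernel k (free_adj a) := kermP (kers _).
  exists (Ker (free_adj a : hom (free F A : triv_ext F) M)), A, k, (free_adj a).
  split=> //; first exact: free_adj_epi.
  have [y [z yz]] := adj_kernel_extension ia ae kP.
  by apply: (Yext _ _ _ _ _ yz) => //; exact: FXY.
have preenvelope (M : triv_ext F) :
    exists (E : triv_ext F) (A : B) (i : hom M E)
      (p : hom E (free F A : triv_ext F)),
      [/\ is_kernel i p, epi p, X A & U_inv F Y E].
  have [_ [N [A [j [q [/short_exactP[jq qe] YN XA]]]]]] := XYc (tcar M).
  have [Tjq Tqe] := free_map_short_exact (L1FX _ XA) jq qe.
  have [E [i [p [k [ip pe kj pk]]]]] :=
    pushout_short_exact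
      (free_adj (idm (tcar M)) : hom (free F _ : triv_ext F) M) Tjq Tqe.
  exists E, A, i, p; split=> //.
  have [y [z yz]] := free_pushout_extension jq qe ip pe kj pk.
  by apply: (Yext _ _ _ _ _ yz) => //; exact: FXY.
split.
- split=> [//|M]; split=> [YM A CA|CM]; first exact: CA.
  have [E [A [i [p [ip pe XA YE]]]]] := preenvelope M.
  (* The preenvelope splits, so [tcar M] is a retract of an object of [Y]. *)
  have /Ext1_lift h := CM _ (freeX _ XA).
  have [s sE] := h _ _ _ _ ip pe (idm _).
  have [r rE] := split_kernel ip sE.
  have /(congr1 (@tmap _ _ _ _)) rE' := rE.
  by apply/YP => D XD; apply: (Ext1_retract rE'); move/YP: YE; apply.
- move=> M; split.
    have [K [A [i [p [ip pe XA YK]]]]] := precover M.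
    exists K, (free F A), i, p.
    by split=> //; [exact/short_exactP | exact: freeX].
  have [E [A [i [p [ip pe XA YE]]]]] := preenvelope M.
  exists E, (free F A), i, p.
  by split=> //; [exact/short_exactP | exact: freeX].
have Csyz (M : triv_ext F) : perp_left (U_inv F Y) M ->
    perp_left (U_inv F Y) (syz M).
  move=> CM N YN.
  have [K [A [i [p [ip pe XA YK]]]]] := precover M.
  (* The precover splits because its kernel lies in the right class; thus [M] is a retract of
     [free F A]. *)
  have [s sE] := (Ext1_lift _ _).1 (CM _ YK) _ _ _ _ ip pe (idm _).
  have XS : X (syz A).
    (* Heredity in degree 2 is vanishing of Ext^1 on the syzygy. *)
    by apply/XP => D YD; exact: (Ext_syz 1 A D).1 (XYh 2 _ _ isT XA YD).
  (* This presents [free F A] with projective middle term and kernel [free F (syz A)]. *)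
  have [kT ceT] := free_map_short_exact (L1FX _ XA) (kermP (kers (cov A)))
                    (coverP A).2.
  apply: (Ext1_syz_retract sE (free_projective (coverP A).1) kT ceT).
  exact: freeX.
move=> [|n] M N // _ CM YN; apply/Ext_syz.
suff : perp_left (U_inv F Y) (iter n (@syz _) M) by apply.
by elim: n => //= n; exact: Csyz.
Qed.
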